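(* Let $d\ge 1$ and $n\ge 0$ be fixed integers. The sequence $\left(\left\langle {n\atop k}\right\rangle^{(d)}_q\right)_{0\le k\le n}$ is strongly $q$-log-concave; that is, for all integers $k,l$ with $0<l\le k<n$, the difference $$\left\langle {n\atop k}\right\rangle^{(d)}_q\left\langle {n\atop l}\right\rangle^{(d)}_q-\left\langle {n\atop k+1}\right\rangle^{(d)}_q\left\langle {n\atop l-1}\right\rangle^{(d)}_q$$ is a polynomial in $q$ with only nonnegative coefficients.
   Context: For $0\le k\le n$ the $q$-analog of the $d$-Hoggatt numbers is $$\left\langle {n\atop k}\right\rangle^{(d)}_q:=q^{d\binom{k}{2}}\prod_{j=0}^{d-1}\frac{\left[{n+j\atop k}\right]_q}{\left[{k+j\atop k}\right]_q},$$ where $\left[{n\atop k}\right]_q:=\frac{[n]_q!}{[k]_q![n-k]_q!}$ is the $q$-binomial coefficient, with $[m]_q:=\frac{1-q^m}{1-q}$ and $[m]_q!:=[1]_q[2]_q\cdots[m]_q$. A sequence $(a_i(q))$ of polynomials over $\mathbb{R}$ is strongly $q$-log-concave if $a_i(q)a_j(q)-a_{i+1}(q)a_{j-1}(q)\in\mathbb{R}_{\ge 0}[q]$ for all indices $i\ge j$ for which $i+1$ and $j-1$ are also in the index range. *)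

(* Defs.v *)
From mathcomp Require Import all_boot all_order all_algebra.
From mathcomp Require Import reals.

Set Implicit Arguments.
Unset Strict Implicit.
Unset Printing Implicit Defensive.

Import Order.TTheory GRing.Theory Num.Theory.
Local Open Scope ring_scope.

(* The q-analogs are rational expressions, evaluated at an element q of a
   field K.  For the formal variable q, take K := {fraction {poly R}} and
   q := 'X; no denominator then vanishes when 0 <= k <= n. *)

Definition qint (K : fieldType) (q : K) (m : nat) : K :=
  (1 - q ^+ m) / (1 - q).

Definition qfact (K : fieldType) (q : K) (m : nat) : K :=
  \prod_(1 <= i < m.+1) qint q i.

Definition qbinom (K : fieldType) (q : K) (n k : nat) : K :=
  qfact q n / (qfact q k * qfact q (n - k)).

Definition qhoggatt (K : fieldType) (q : K) (d n k : nat) : K :=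
  q ^+ (d * 'C(k, 2)) *
  \prod_(0 <= j < d) (qbinom q (n + j) k / qbinom q (k + j) k).

Definition fracX (R : idomainType) : {fraction {poly R}} := tofrac 'X.

(* The sequence is a 0, ..., a n; values of a beyond n are irrelevant. *)
Definition strongly_q_log_concave (R : realType) (n : nat)
    (a : nat -> {poly R}) : Prop :=
  forall i j : nat, (j <= i)%N -> (i + 1 <= n)%N -> (1 <= j)%N ->
    a i * a j - a (i + 1)%N * a (j - 1)%N \is a polyOver Num.nneg.

(* Main.v *)
Require Import Defs.
From mathcomp Require Import all_boot all_order all_algebra.
From mathcomp Require Import reals.
From mathcomp Require Import ring zify.

(** The q-Hoggatt number with parameters n, k, d is the principal
    specialization s(1, q, ..., q^(n-1)) of the Schur function of the k x d
    rectangle.  Two facts about it are combined.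

    Positivity.  Encode a semistandard tableau by its Gelfand-Tsetlin pattern:
    n rows below a fixed top row d, ..., d, 0, ..., 0 with k entries d, each
    row interlacing the row above it, ending in a prescribed bottom row.  With
    bottom row 0 such patterns, weighted by q to the sum of the entries, are
    counted by the q-Hoggatt number.  With bottom row d, 0, ..., 0 the first
    column is frozen at d, and removing it lowers k by one: this costs a
    factor q^(nd).  Entrywise maximum and minimum preserve interlacing.  Take
    a pattern with k + 1 top entries d and bottom 0, and a pattern with l top
    entries d and bottom d, 0, ..., 0; since l <= k + 1, their maximum has the
    top row of the first and the bottom row of the second, and their minimum
    the converse.  Up to the factor q^(nd), the pairs that enter are counted
    by the product for (k + 1, l - 1), and those in which the maximum and
    minimum live by the product for (k, l).  Hence a four functions theorem
    compares the two products; it has to hold coefficient by coefficient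
    (q_four_functions).  For that, fix the minimum u and maximum v of a pair:
    the pairs over (u, v) all have the same weight, and are complementary pairs
    in a Boolean lattice.  Complementary pairs are compared by applying the
    classical Ahlswede-Daykin theorem to products of a function with the
    complement of another one (four_functions_compl), which is how the
    Marica-Schoenheim inequality follows from it.

    Evaluation.  Put l_i = z_i + t - 1 - i for a row z of length t.  The sum of
    q^(m j) over z_(i+1) <= m - (t-2-i) <= z_i is geometric and equals
    (q^(l_(i+1) j) - q^(l_i j)) / (1 - q^j).  Therefore the differences of
    consecutive columns of the Vandermonde matrix in the q^(l_i) turn its
    determinant into a constant times a sum of smaller such determinants over
    the rows interlacing z (vdm_branching), and the generating function of
    patterns is, up to a constant, a Vandermonde determinant
    (genfun_pattern_vdm).  For a rectangle it is evaluated by increasing d by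
    one, where the product over pairs changes by a telescoping factor
    (vdm_rect_qhoggatt). *)

Set Implicit Arguments.
Unset Strict Implicit.
Unset Printing Implicit Defensive.

Import Order.TTheory GRing.Theory Num.Theory.
Local Open Scope ring_scope.

(** * The four functions theorem on a Boolean lattice *)

(** The case of a one-point set.  With X = c1 d0 and Y = c0 d1, the numbers
    p = a0 b1 and r = a1 b0 are at most X and p r <= X Y, so that
    (X - p)(X - r) >= 0 gives X (p + r) <= X (X + Y). *)
Lemma four_numbers (a0 a1 b0 b1 c0 c1 d0 d1 : nat) :
  (a0 * b0 <= c0 * d0)%N -> (a1 * b1 <= c1 * d1)%N ->
  (a0 * b1 <= c1 * d0)%N -> (a1 * b0 <= c1 * d0)%N ->
  ((a0 + a1) * (b0 + b1) <= (c0 + c1) * (d0 + d1))%N.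
Proof.
move=> h00 h11 h01 h10.
suff mid : (a0 * b1 + a1 * b0 <= c1 * d0 + c0 * d1)%N.
  by nia.
have [x0|x_gt0] := posnP (c1 * d0); first by nia.
have prod_le : ((a0 * b1) * (a1 * b0) <= (c1 * d0) * (c0 * d1))%N.
  by have := leq_mul h00 h11; nia.
rewrite -(leq_pmul2l x_gt0).
move: (c1 * d0)%N (c0 * d1)%N (a0 * b1)%N (a1 * b0)%N h01 h10 prod_le x_gt0.
move=> X Y p r /subnK <-; move: (X - p)%N => u; nia.
Qed.

Lemma sum_subset_setU1 (I : finType) (a : I) (U : {set I}) (F : {set I} -> nat) :
  a \notin U ->
  (\sum_(S : {set I} | S \subset a |: U) F S =
   \sum_(S : {set I} | S \subset U) F S + \sum_(S : {set I} | S \subset U) F (a |: S))%N.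
Proof.
move=> aU; rewrite (bigID (fun S : {set I} => a \in S)) /= addnC; congr addn.
  apply: eq_bigl => S; apply/andP/idP => [[sSU aS]|sSU].
    by rewrite -(setU1K aU) subsetD1 sSU.
  by split; [exact: subset_trans sSU (subsetUr _ _)|apply: contra aU; apply: subsetP].
rewrite (reindex_onto (fun S => a |: S) (fun S => S :\ a)) /=; last first.
  by move=> S /andP[_ aS]; rewrite setD1K.
apply: eq_bigl => S; rewrite setU11 andbT; apply/andP/idP => [[sSU /eqP eqS]|sSU].
  have aS : a \notin S by rewrite -eqS setD11.
  apply/subsetP => x xS; have /setU1P[xa|//] : x \in a |: U.
    by apply: (subsetP sSU); rewrite inE xS orbT.
  by rewrite xa (negbTE aS) in xS * .
have aS : a \notin S by apply: contra aU; apply: subsetP.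
by rewrite setUS // setU1K.
Qed.

(** The Ahlswede-Daykin theorem: summing each function over the membership of
    one point a reduces U to U without a, and the hypothesis survives by the
    case of one point. *)
Lemma four_functions (I : finType) (U : {set I}) (al be ga de : {set I} -> nat) :
  (forall S T : {set I}, S \subset U -> T \subset U ->
     (al S * be T <= ga (S :|: T) * de (S :&: T))%N) ->
  ((\sum_(S : {set I} | S \subset U) al S) * (\sum_(S : {set I} | S \subset U) be S) <=
   (\sum_(S : {set I} | S \subset U) ga S) * (\sum_(S : {set I} | S \subset U) de S))%N.
Proof.
have [k] := ubnP #|U|; elim: k U al be ga de => // k IHk U al be ga de.
case: (set_0Vmem U) => [-> _ h|[a aU] ltUk h].
  by rewrite !(eq_bigl (pred1 set0)) ?big_pred1_eq => [|S|S|S|S]; rewrite ?subset0 //;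
    have := h set0 set0 (sub0set _) (sub0set _); rewrite setU0 setI0.
have aU' : a \notin U :\ a by rewrite setD11.
rewrite -(setD1K aU) !sum_subset_setU1 // -!big_split /=.
apply: IHk => [|S T sS sT].
  by move: ltUk; rewrite (cardsD1 a U) aU ltnS.
have sSU := subset_trans sS (subsetDl _ _).
have sTU := subset_trans sT (subsetDl _ _).
have aS : a \notin S by apply: contra aU'; apply: subsetP.
have aT : a \notin T by apply: contra aU'; apply: subsetP.
have s1 : [set a] \subset U by rewrite sub1set.
have h00 := h S T sSU sTU.
have h11 := h (a |: S) (a |: T); rewrite -setUUr -setUIr !subUset s1 sSU sTU in h11.
have h01 := h S (a |: T); rewrite setUCA setIUr !subUset s1 sSU sTU in h01.
have h10 := h (a |: S) T; rewrite -setUA setIUl !subUset s1 sSU sTU in h10.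
have SaN : S :&: [set a] = set0.
  by apply/setP => x; rewrite !inE andbC; case: eqP => // ->; exact: negbTE.
have TaN : [set a] :&: T = set0.
  by apply/setP => x; rewrite !inE; case: eqP => // ->; exact: negbTE.
rewrite SaN set0U in h01; rewrite TaN set0U in h10.
exact: four_numbers h00 (h11 isT isT) (h01 isT isT) (h10 isT isT).
Qed.

Lemma setDK (I : finType) (U S : {set I}) : S \subset U -> U :\: (U :\: S) = S.
Proof. by move=> sSU; rewrite setDDr setDv set0U; apply/setIidPr. Qed.

(** The square of the left hand side is a product of two sums, one of which can
    be re-indexed by complements.  To the pair S, T belongs
    (al S * be T) * (al (U - T) * be (U - S)), and the hypothesis on each factor
    produces the sets S :|: T and S :&: T together with their complements. *)
Lemma four_functions_compl (I : finType) (U : {set I}) (al be ga de : {set I} -> nat) :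
  (forall S T : {set I}, S \subset U -> T \subset U ->
     (al S * be T <= ga (S :|: T) * de (S :&: T))%N) ->
  (\sum_(S : {set I} | S \subset U) al S * be (U :\: S) <=
   \sum_(S : {set I} | S \subset U) ga S * de (U :\: S))%N.
Proof.
move=> h; rewrite -leq_sqr -!mulnn.
have compl (F : {set I} -> nat) :
    (\sum_(S : {set I} | S \subset U) F (U :\: S) = \sum_(S : {set I} | S \subset U) F S)%N.
  rewrite [RHS](reindex_onto (fun S => U :\: S) (fun S => U :\: S)) /=; last first.
    by move=> S; apply: setDK.
  apply: eq_bigl => S; rewrite subsetDl; apply/idP/eqP => [|<-]; first exact: setDK.
  exact: subsetDl.
rewrite -{2}compl -[X in (_ <= _ * X)%N]compl.
apply: four_functions => S T sS sT.
have h1 := h S T sS sT.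
have h2 := h (U :\: T) (U :\: S) (subsetDl _ _) (subsetDl _ _).
rewrite -setDIr -setDUr [T :&: S]setIC [T :|: S]setUC in h2.
rewrite !setDK // ?(subset_trans (subsetIl _ _)) //.
by have := leq_mul h1 h2; lia.
Qed.

(** * A coefficientwise four functions theorem for products of chains *)

Definition fmin (I : finType) m (x y : {ffun I -> 'I_m}) : {ffun I -> 'I_m} :=
  [ffun i => if (x i <= y i)%N then x i else y i].
Definition fmax (I : finType) m (x y : {ffun I -> 'I_m}) : {ffun I -> 'I_m} :=
  [ffun i => if (x i <= y i)%N then y i else x i].
Definition weight (I : finType) m (x : {ffun I -> 'I_m}) : nat := (\sum_i x i)%N.

Lemma val_fmin (I : finType) m (x y : {ffun I -> 'I_m}) i :
  fmin x y i = minn (x i) (y i) :> nat.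
Proof. by rewrite ffunE; case: leqP. Qed.

Lemma val_fmax (I : finType) m (x y : {ffun I -> 'I_m}) i :
  fmax x y i = maxn (x i) (y i) :> nat.
Proof. by rewrite ffunE; case: leqP. Qed.

Lemma fminC (I : finType) m (x y : {ffun I -> 'I_m}) : fmin x y = fmin y x.
Proof. by apply/ffunP => i; apply/val_inj; rewrite /= !val_fmin minnC. Qed.

Lemma fmaxC (I : finType) m (x y : {ffun I -> 'I_m}) : fmax x y = fmax y x.
Proof. by apply/ffunP => i; apply/val_inj; rewrite /= !val_fmax maxnC. Qed.

(** All pairs with the same minimum and maximum therefore have the same weight. *)
Lemma weight_fmin_fmax (I : finType) m (x y : {ffun I -> 'I_m}) :
  (weight (fmin x y) + weight (fmax x y) = weight x + weight y)%N.
Proof.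
rewrite /weight -!big_split; apply: eq_bigr => i _; rewrite !ffunE.
by case: ifP => _ //=; rewrite addnC.
Qed.

Definition splits (I : finType) m (P Q : pred {ffun I -> 'I_m}) (u v : {ffun I -> 'I_m}) :
    pred ({ffun I -> 'I_m} * {ffun I -> 'I_m}) :=
  [pred p | [&& P p.1, Q p.2 & (fmin p.1 p.2, fmax p.1 p.2) == (u, v)]].

Definition mix (I : finType) m (u v : {ffun I -> 'I_m}) (S : {set I}) : {ffun I -> 'I_m} :=
  [ffun i => if i \in S then v i else u i].

(** A pair with minimum u and maximum v is determined by the set of coordinates
    where u and v differ and its first component takes the value of v; the
    second component then corresponds to the complementary set. *)
Lemma card_splits (I : finType) m (P Q : pred {ffun I -> 'I_m}) (u v : {ffun I -> 'I_m}) :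
  (forall i, (u i <= v i)%N) ->
  let U := [set i | u i != v i] in
  #|splits P Q u v| =
  (\sum_(S : {set I} | S \subset U) P (mix u v S) * Q (mix u v (U :\: S)))%N.
Proof.
move=> leuv U.
rewrite -sum1_card (reindex_onto (fun S : {set I} => (mix u v S, mix u v (U :\: S)))
  (fun p => [set i | p.1 i != u i])) /=; last first.
  move=> [x y] /= /and3P[_ _ /eqP[/ffunP eu /ffunP ev]].
  congr pair; apply/ffunP => i; move: (eu i) (ev i); rewrite !ffunE !inE /=;
    case: ifP => _ <- <-; rewrite ?eqxx //; case: eqVneq => //=; by case: eqVneq.
rewrite (eq_bigl (fun S : {set I} =>
  (S \subset U) && (P (mix u v S) && Q (mix u v (U :\: S))))).
  by rewrite big_mkcondr; apply: eq_bigr => S _; case: (P _); case: (Q _).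
move=> S; rewrite -topredE /=.
have -> : ([set i | mix u v S i != u i] == S) = (S \subset U).
  apply/eqP/subsetP => [eS i iS|sSU].
    by move: (iS); rewrite -{1}eS !inE ffunE iS eq_sym.
  apply/setP => i; rewrite inE ffunE; case: ifP => [/sSU|_]; last by rewrite eqxx.
  by rewrite inE eq_sym => ->.
have [sSU|_] := boolP (S \subset U); rewrite ?andbF //= andbT.
rewrite /splits inE /=.
suff -> : (fmin (mix u v S) (mix u v (U :\: S)),
           fmax (mix u v S) (mix u v (U :\: S))) == (u, v).
  by rewrite andbT.
have eq_le i : (v i <= u i)%N -> u i = v i.
  by move=> levu; apply/val_inj/eqP; rewrite eqn_leq leuv.
apply/eqP; congr pair; apply/ffunP => i; rewrite !ffunE !inE;
  case: (boolP (i \in S)) => [iS|_] /=.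
- by case: ifP => // /eq_le.
- by case: eqVneq => [->|_]; rewrite ?if_same // leuv.
- by case: ifP => // /eq_le.
- by case: eqVneq => [->|_]; rewrite ?if_same // leuv.
Qed.

Lemma leq_card_splits (I : finType) m (A B C D : pred {ffun I -> 'I_m}) u v :
  (forall x y, A x -> B y -> C (fmax x y) && D (fmin x y)) ->
  (#|splits A B u v| <= #|splits C D u v|)%N.
Proof.
move=> h; have [/forallP leuv|Nleuv] := boolP [forall i, (u i <= v i)%N]; last first.
  rewrite eq_card0 // => -[x y]; apply: contraNF Nleuv; rewrite inE /=.
  case/and3P => _ _ /eqP[<- <-]; apply/forallP => i; rewrite !ffunE.
  by case: ifP => // /negbT; rewrite -ltnNge => /ltnW.
rewrite !card_splits //=; set U := [set i | _].
apply: (four_functions_compl (al := fun S => A (mix u v S)) (be := fun S => B (mix u v S))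
  (ga := fun S => C (mix u v S)) (de := fun S => D (mix u v S))) => S T _ _.
case: (boolP (A _)) => // AS; case: (boolP (B _)) => // BT.
have /andP[] := h _ _ AS BT.
have -> : fmax (mix u v S) (mix u v T) = mix u v (S :|: T).
  apply/ffunP => i; rewrite !ffunE inE.
  case: (i \in S); case: (i \in T) => //=; rewrite ?if_same ?leuv //.
  by case: ifP => // h'; apply/val_inj/eqP; rewrite eqn_leq leuv h'.
have -> : fmin (mix u v S) (mix u v T) = mix u v (S :&: T).
  apply/ffunP => i; rewrite !ffunE inE.
  case: (i \in S); case: (i \in T) => //=; rewrite ?if_same ?leuv //.
  by case: ifP => // h'; apply/val_inj/eqP; rewrite eqn_leq leuv h'.
by move=> -> ->.
Qed.

Definition genfun (R : nzRingType) (I : finType) m (P : pred {ffun I -> 'I_m}) : {poly R} :=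
  \sum_(x | P x) 'X^(weight x).

Lemma genfunM (R : nzRingType) (I : finType) m (P Q : pred {ffun I -> 'I_m}) :
  genfun R P * genfun R Q =
  \sum_(uv : {ffun I -> 'I_m} * {ffun I -> 'I_m})
     'X^(weight uv.1 + weight uv.2) *+ #|splits P Q uv.1 uv.2|.
Proof.
rewrite /genfun big_distrlr /= pair_big.
rewrite (partition_big (fun p => (fmin p.1 p.2, fmax p.1 p.2)) predT) //=.
apply: eq_bigr => -[u v] _ /=; rewrite -sumr_const.
apply: eq_big => [p|[x y] /= /andP[_ /eqP[<- <-]]]; first by rewrite /splits inE /= andbA.
by rewrite weight_fmin_fmax exprD.
Qed.

(** By genfunM both products are sums over (u, v) of a common power of the
    variable times the size of a fibre, and the fibres compare one by one. *)
Lemma q_four_functions (R : numDomainType) (I : finType) m (A B C D : pred {ffun I -> 'I_m}) :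
  (forall x y, A x -> B y -> C (fmax x y) && D (fmin x y)) ->
  genfun R C * genfun R D - genfun R A * genfun R B \is a polyOver Num.nneg.
Proof.
move=> h; rewrite !genfunM -sumrB; apply/polyOverP => k.
rewrite coef_sum nnegrE; apply: sumr_ge0 => -[u v] _ /=.
by rewrite -mulrnBr ?leq_card_splits // coefMn coefXn mulrn_wge0 ?ler0n.
Qed.

(** * Interlacing patterns with prescribed top and bottom rows *)

Definition interlaces K m (x y : {ffun 'I_K -> 'I_m}) : bool :=
  [forall i, (y i <= x i)%N] &&
  [forall i : 'I_K, forall j : 'I_K, (j == i.+1 :> nat) ==> (x j <= y i)%N].

Lemma interlacesP K m (x y : {ffun 'I_K -> 'I_m}) :
  reflect ((forall i, y i <= x i)%N /\ (forall i j : 'I_K, j = i.+1 :> nat -> x j <= y i)%N)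
    (interlaces x y).
Proof.
apply: (iffP andP) => -[h1 h2]; split; [exact/forallP| |exact/forallP|].
  by move=> i j /eqP; apply/implyP/(forallP (forallP h2 i)).
by apply/forallP => i; apply/forallP => j; apply/implyP => /eqP /h2.
Qed.

Lemma interlaces_fmax K m (x y x' y' : {ffun 'I_K -> 'I_m}) :
  interlaces x y -> interlaces x' y' -> interlaces (fmax x x') (fmax y y').
Proof.
case/interlacesP => h1 h2 /interlacesP[h1' h2'].
apply/interlacesP; split => [i|i j eij]; rewrite !val_fmax geq_max !leq_max.
  by rewrite h1 h1' orbT.
by rewrite (h2 i j) // (h2' i j) // orbT.
Qed.

Lemma interlaces_fmin K m (x y x' y' : {ffun 'I_K -> 'I_m}) :
  interlaces x y -> interlaces x' y' -> interlaces (fmin x x') (fmin y y').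
Proof.
case/interlacesP => h1 h2 /interlacesP[h1' h2'].
apply/interlacesP; split => [i|i j eij]; rewrite !val_fmin leq_min !geq_min.
  by rewrite h1 h1' orbT.
by rewrite (h2 i j) // (h2' i j) // orbT.
Qed.

Definition pattern_row n K m (x : {ffun 'I_n * 'I_K -> 'I_m}) (t : 'I_n) :
    {ffun 'I_K -> 'I_m} := [ffun i => x (t, i)].

(** The top row is not part of the array; the bottom row is its last row, or the
    top row itself when n = 0.  All rows have the same length K, so that
    patterns with different top and bottom rows live in one product of chains. *)
Definition pattern n K m (top bot : {ffun 'I_K -> 'I_m}) :
    pred {ffun 'I_n * 'I_K -> 'I_m} :=
  fun x => let rows := [seq pattern_row x t | t <- enum 'I_n] in
    path (@interlaces K m) top rows && (last top rows == bot).

Lemma path_map2 (T J : Type) (r : rel T) (op : T -> T -> T) :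
  (forall x y x' y', r x y -> r x' y' -> r (op x x') (op y y')) ->
  forall (f g : J -> T) s a b, path r a (map f s) -> path r b (map g s) ->
    path r (op a b) [seq op (f j) (g j) | j <- s].
Proof.
move=> h f g; elim=> //= j s IHs a b /andP[h1 p1] /andP[h2 p2].
by rewrite h //= IHs.
Qed.

Lemma last_map2 (T J : Type) (op : T -> T -> T) (f g : J -> T) s a b :
  last (op a b) [seq op (f j) (g j) | j <- s] = op (last a (map f s)) (last b (map g s)).
Proof. by elim: s a b => /=. Qed.

Lemma pattern_fmax n K m (a b a' b' : {ffun 'I_K -> 'I_m}) (x y : {ffun 'I_n * 'I_K -> 'I_m}) :
  pattern a b x -> pattern a' b' y -> pattern (fmax a a') (fmax b b') (fmax x y).
Proof.
case/andP => px /eqP lx /andP[py /eqP ly]; rewrite /pattern.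
have -> : [seq pattern_row (fmax x y) t | t <- enum 'I_n] =
    [seq fmax (pattern_row x t) (pattern_row y t) | t <- enum 'I_n].
  by apply: eq_map => t; apply/ffunP => i; rewrite !ffunE.
by rewrite last_map2 lx ly eqxx andbT path_map2 //; apply: interlaces_fmax.
Qed.

Lemma pattern_fmin n K m (a b a' b' : {ffun 'I_K -> 'I_m}) (x y : {ffun 'I_n * 'I_K -> 'I_m}) :
  pattern a b x -> pattern a' b' y -> pattern (fmin a a') (fmin b b') (fmin x y).
Proof.
case/andP => px /eqP lx /andP[py /eqP ly]; rewrite /pattern.
have -> : [seq pattern_row (fmin x y) t | t <- enum 'I_n] =
    [seq fmin (pattern_row x t) (pattern_row y t) | t <- enum 'I_n].
  by apply: eq_map => t; apply/ffunP => i; rewrite !ffunE.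
by rewrite last_map2 lx ly eqxx andbT path_map2 //; apply: interlaces_fmin.
Qed.

Definition rect K d e : {ffun 'I_K -> 'I_d.+1} :=
  [ffun i : 'I_K => if (i < e)%N then ord_max else ord0].

Lemma fmax_rect K d e e' : (e <= e')%N -> fmax (rect K d e) (rect K d e') = rect K d e'.
Proof.
move=> le_ee; apply/ffunP => i; rewrite !ffunE; case: (ltnP i e) => [lt_ie|_].
  by rewrite (leq_trans lt_ie le_ee) leqnn.
by rewrite leq0n.
Qed.

Lemma fmin_rect K d e e' : (e <= e')%N -> fmin (rect K d e) (rect K d e') = rect K d e.
Proof.
move=> le_ee; apply/ffunP => i; rewrite !ffunE; case: (ltnP i e) => [lt_ie|_].
  by rewrite (leq_trans lt_ie le_ee) leqnn.
by rewrite leq0n.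
Qed.

(** The maximum of a pattern from top e to bottom b and one from top e' to
    bottom b' goes from e to b', and the minimum goes from e' to b. *)
Lemma genfun_rect_exchange (R : numDomainType) n K d b b' e e' :
  (b <= b')%N -> (e' <= e)%N ->
  genfun R (@pattern n K d.+1 (rect K d e) (rect K d b')) *
    genfun R (@pattern n K d.+1 (rect K d e') (rect K d b)) -
  genfun R (@pattern n K d.+1 (rect K d e) (rect K d b)) *
    genfun R (@pattern n K d.+1 (rect K d e') (rect K d b'))
  \is a polyOver Num.nneg.
Proof.
move=> le_b le_e; apply: q_four_functions => x y px py.
have := pattern_fmax px py; have := pattern_fmin px py.
by rewrite (fmaxC (rect K d e)) (fminC (rect K d e)) !fmax_rect ?fmin_rect // => -> ->.
Qed.

Definition pattern_cons n K m (y : {ffun 'I_K -> 'I_m}) (x : {ffun 'I_n * 'I_K -> 'I_m}) :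
    {ffun 'I_n.+1 * 'I_K -> 'I_m} :=
  [ffun p => if unlift ord0 p.1 is Some t then x (t, p.2) else y p.2].

Lemma weight_rows n K m (x : {ffun 'I_n * 'I_K -> 'I_m}) :
  weight x = (\sum_t \sum_i x (t, i))%N.
Proof. by rewrite pair_bigA; apply: eq_bigr => -[]. Qed.

Lemma genfun_pattern0 (R : nzRingType) K m (top bot : {ffun 'I_K -> 'I_m}) :
  genfun R (@pattern 0 K m top bot) = (top == bot)%:R.
Proof.
have no_cell (p : 'I_0 * 'I_K) : False by case: p => -[].
pose x0 : {ffun 'I_0 * 'I_K -> 'I_m} := [ffun p => False_rect _ (no_cell p)].
rewrite /genfun /pattern enum_ord0 /=.
case: (top == bot); last by rewrite big_pred0.
rewrite (big_pred1 x0) => [|x].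
  by rewrite /weight big1 ?expr0 // => p; case: (no_cell p).
by apply/esym/eqP/ffunP => p; case: (no_cell p).
Qed.

Lemma genfun_patternS (R : nzRingType) n K m (top bot : {ffun 'I_K -> 'I_m}) :
  genfun R (@pattern n.+1 K m top bot) =
  \sum_(y | interlaces top y) 'X^(weight y) * genfun R (@pattern n K m y bot).
Proof.
pose h (yx : {ffun 'I_K -> 'I_m} * {ffun 'I_n * 'I_K -> 'I_m}) := pattern_cons yx.1 yx.2.
have h_bij : bijective h.
  exists (fun x => (pattern_row x ord0, [ffun p => x (lift ord0 p.1, p.2)])).
    move=> [y x]; rewrite /h /pattern_cons /=; congr pair; apply/ffunP => i.
      by rewrite !ffunE /= unlift_none.
    by rewrite !ffunE /= liftK; case: i.
  move=> x; apply/ffunP => -[t i]; rewrite !ffunE /=.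
  by case: unliftP => [j|] ->; rewrite ?ffunE.
rewrite /genfun (reindex h) /=; last exact: onW_bij.
under [RHS]eq_bigr => y _ do rewrite big_distrr /=.
rewrite pair_big_dep /=; apply: eq_big => -[y x].
  rewrite /pattern enum_ordSl /= -map_comp.
  have -> : pattern_row (h (y, x)) ord0 = y.
    by apply/ffunP => i; rewrite !ffunE /= unlift_none.
  rewrite -andbA; congr andb; congr andb; [congr path|congr (last _ _ == _)];
    by apply: eq_map => t; apply/ffunP => i; rewrite !ffunE /= liftK.
move=> _ /=; rewrite -exprD; congr ('X^ _).
rewrite !weight_rows big_ord_recl.
congr addn; first by apply: eq_bigr => i _; rewrite ffunE /= unlift_none.
by apply: eq_bigr => t _; apply: eq_bigr => i _; rewrite ffunE /= liftK.
Qed.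

(** * Branching of Vandermonde determinants *)

Lemma sum_mul_delta (R : pzRingType) (I : finType) (F : I -> R) (c : I) :
  \sum_i F i * (i == c)%:R = F c.
Proof.
rewrite (bigD1 c) //= eqxx mulr1 big1 ?addr0 // => i /negbTE ->.
by rewrite mulr0.
Qed.

(** Subtracting from each column the preceding one turns the first row, which
    is constant, into 1, 0, ..., 0. *)
Lemma det_Vandermonde_diff (R : comPzRingType) t (a : 'rV[R]_t.+1) :
  \det (Vandermonde t.+1 a) =
  \det (\matrix_(j < t, i < t)
          (a 0 (lift ord0 i) ^+ j.+1 - a 0 (widen_ord (leqnSn t) i) ^+ j.+1)).
Proof.
pose B : 'M[R]_t.+1 := \matrix_(i, j) ((i == j)%:R - (i.+1 == j :> nat)%:R).
have detB : \det B = 1.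
  rewrite -det_tr det_trig ?big1 // => [i _|]; first by rewrite !mxE eqxx gtn_eqF ?subr0.
  apply/is_trig_mxP => i j lt_ij; rewrite !mxE.
  by rewrite -val_eqE !gtn_eqF ?subr0 //= ltnW.
rewrite -[LHS]mulr1 -detB -det_mulmx.
set V := Vandermonde _ _; have VB0 r : (V *m B) r ord0 = V r ord0.
  rewrite mxE (eq_bigr (fun i => V r i * (i == ord0)%:R)) ?sum_mul_delta // => i _.
  by rewrite [B _ _]mxE /= subr0.
have VBS r j : (V *m B) r (lift ord0 j) = V r (lift ord0 j) - V r (widen_ord (leqnSn t) j).
  rewrite mxE (eq_bigr (fun i => V r i * (i == lift ord0 j)%:R -
     V r i * (i == widen_ord (leqnSn t) j)%:R)) ?sumrB ?sum_mul_delta // => i _.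
  by rewrite [B _ _]mxE mulrBr lift0 eqSS.
rewrite (expand_det_row _ ord0) big_ord_recl big1 => [|j _].
  rewrite addr0 VB0 mxE expr0 mul1r /cofactor expr0 mul1r.
  by congr (\det _); apply/matrixP => j i; rewrite mxE [LHS]mxE VBS !mxE.
by rewrite VBS !mxE subrr mul0r.
Qed.

Lemma det_sum_family (R : comPzRingType) (J : finType) t (Q : 'I_t -> pred J)
    (F : 'I_t -> 'I_t -> J -> R) :
  \det (\matrix_(j, i) \sum_(m | Q i m) F j i m) =
  \sum_(w in family Q) \det (\matrix_(j, i) F j i (w i)).
Proof.
rewrite -det_tr; under [RHS]eq_bigr => w _ do rewrite -det_tr.
rewrite /determinant exchange_big /=; apply: eq_bigr => s _.
rewrite -big_distrr /=; congr (_ * _).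
under eq_bigr => i _ do rewrite !mxE.
rewrite bigA_distr_big_dep; apply: eq_bigr => w _.
by apply: eq_bigr => i _; rewrite !mxE.
Qed.

Lemma telescope_ord (R : zmodType) (f : nat -> R) m a b : (a <= b < m)%N ->
  \sum_(i < m | (a <= i <= b)%N) (f i - f i.+1) = f a - f b.+1.
Proof.
case/andP=> le_ab lt_bm.
rewrite -opprB -(telescope_sumr f (leqW le_ab)) -sumrN.
under [RHS]eq_bigr => i _ do rewrite opprB.
rewrite (big_nat_widenl _ 0) // (big_nat_widen _ _ m) // big_mkord.
by apply: eq_bigl => i; rewrite ltnS.
Qed.

(** The alternant of the partition z: the exponents z_i + t - 1 - i are the
    strictly decreasing shifted parts. *)
Definition vdm (R : comPzRingType) (q : R) t m (z : {ffun 'I_t -> 'I_m}) : R :=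
  \det (Vandermonde t (\row_i q ^+ (z i + rev_ord i))).

(** The values allowed in position i of a row of length t that interlaces the
    row z of length t + 1. *)
Definition between t m (z : {ffun 'I_t.+1 -> 'I_m}) (i : 'I_t) : pred 'I_m :=
  fun w => (z (lift ord0 i) <= w <= z (widen_ord (leqnSn t) i))%N.

Definition nonincr t m (z : {ffun 'I_t -> 'I_m}) : Prop :=
  forall i j : 'I_t, (i <= j)%N -> (z j <= z i)%N.

(** The first product collects the denominators of the geometric sums, the
    second what is left of the nodes factored out of the columns once their
    parts q^(w_i) are counted in the weight. *)
Definition vdm_factor (R : comPzRingType) (q : R) t : R :=
  (\prod_(j < t) (1 - q ^+ j.+1)) * \prod_(i < t) q ^+ rev_ord i.

(** After det_Vandermonde_diff every entry is a factor that depends on its row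
    alone times a sum over the values in one interlacing position; the
    determinant is then expanded multilinearly in its columns. *)
Lemma vdm_branching (R : comPzRingType) (q : R) t m (z : {ffun 'I_t.+1 -> 'I_m}) :
  nonincr z ->
  vdm q z = vdm_factor q t * \sum_(w in family (between z)) q ^+ weight w * vdm q w.
Proof.
move=> zP; rewrite /vdm det_Vandermonde_diff /vdm_factor -mulrA.
set M := (X in \det X = _).
have -> : M = diag_mx (\row_j (1 - q ^+ j.+1)) *m
    \matrix_(j < t, i < t) \sum_(w | between z i w) q ^+ ((w + rev_ord i) * j.+1).
  apply/matrixP => j i; rewrite mul_diag_mx !mxE /= big_distrr /=.
  (* A geometric sum: (1 - q^(j+1)) times its term at w is f w - f (w + 1). *)
  pose f k := q ^+ ((k + rev_ord i) * j.+1).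
  rewrite (eq_bigr (fun w : 'I_m => f w - f w.+1)) => [|w _]; last first.
    by rewrite mulrBl mul1r -exprD /f addSn mulSn.
  rewrite (telescope_ord f); last by rewrite ltn_ord zP //= leqW.
  rewrite /f -!exprM /= /bump add1n; congr (q ^+ (_ * _) - q ^+ (_ * _)).
  by have := ltn_ord i; lia.
rewrite det_mulmx det_diag; congr (_ * _).
  by apply: eq_bigr => j _; rewrite mxE.
rewrite det_sum_family big_distrr /=; apply: eq_bigr => w _.
rewrite mulrA /weight expr_sum -big_split /=.
have -> : \matrix_(j < t, i < t) q ^+ ((w i + rev_ord i) * j.+1) =
    Vandermonde t (\row_i q ^+ (w i + rev_ord i)) *m diag_mx (\row_i q ^+ (w i + rev_ord i)).
  by apply/matrixP => j i; rewrite mul_mx_diag !mxE -exprM -exprD mulnS addnC.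
rewrite det_mulmx det_diag mulrC; congr (_ * _).
by apply: eq_bigr => i _; rewrite mxE exprD mulrC.
Qed.

(** * Evaluation of the generating function of patterns *)

(** In a pattern with t rows and bottom row rect s, the row above these t rows
    starts with s entries d and vanishes from position s + t on.  Padding fills
    a row z of length t with these forced entries. *)
Definition padn d s t (z : {ffun 'I_t -> 'I_d.+1}) (i : nat) : 'I_d.+1 :=
  if (i < s)%N then ord_max else if insub (i - s)%N is Some j then z j else ord0.

Definition pad K d s t (z : {ffun 'I_t -> 'I_d.+1}) : {ffun 'I_K -> 'I_d.+1} :=
  [ffun i : 'I_K => padn s z i].

Definition unpad K d s t (x : {ffun 'I_K -> 'I_d.+1}) : {ffun 'I_t -> 'I_d.+1} :=
  [ffun j : 'I_t => if insub (s + j)%N is Some i then x i else ord0].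

Lemma padn_lt d s t (z : {ffun 'I_t -> 'I_d.+1}) i : (i < s)%N -> padn s z i = ord_max.
Proof. by rewrite /padn => ->. Qed.

Lemma padn_mid d s t (z : {ffun 'I_t -> 'I_d.+1}) (j : 'I_t) : padn s z (s + j) = z j.
Proof. by rewrite /padn ltnNge leq_addr /= addKn valK. Qed.

Lemma padn_ge d s t (z : {ffun 'I_t -> 'I_d.+1}) i : (s + t <= i)%N -> padn s z i = ord0.
Proof.
move=> le_i; rewrite /padn ltnNge (leq_trans (leq_addr _ _) le_i) /= insubN //.
by rewrite -leqNgt leq_subRL // (leq_trans (leq_addr _ _) le_i).
Qed.

Lemma weight_pad K d s t (z : {ffun 'I_t -> 'I_d.+1}) : (s + t <= K)%N ->
  weight (pad K s z) = (s * d + weight z)%N.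
Proof.
move=> leK; rewrite /weight; under eq_bigr => i _ do rewrite ffunE.
rewrite -(big_mkord xpredT (fun i => val (padn s z i))).
rewrite (@big_cat_nat _ _ _ (s + t)) //= (@big_cat_nat _ _ _ s) ?leq_addr //=.
rewrite [X in (_ + X)%N]big_nat_cond [X in (_ + X)%N]big1 => [|i]; last first.
  by rewrite andbT => /andP[/padn_ge ->].
rewrite addn0; congr addn.
  rewrite big_nat_cond (eq_bigr (fun=> d)) => [|i]; last by rewrite andbT => /padn_lt ->.
  by rewrite -big_nat_cond sum_nat_const_nat subn0.
rewrite -{1}[s]add0n [(s + t)%N]addnC big_addn addnK big_mkord.
by apply: eq_bigr => i _; rewrite addnC padn_mid.
Qed.

Lemma unpadK K d s t (z : {ffun 'I_t -> 'I_d.+1}) : (s + t <= K)%N ->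
  unpad s t (pad K s z) = z.
Proof.
move=> leK; apply/ffunP => j; rewrite ffunE.
have lt_j : (s + j < K)%N by rewrite (leq_trans _ leK) // ltn_add2l.
by rewrite insubT ffunE /= padn_mid.
Qed.

Lemma pad_unpad K d s t (x : {ffun 'I_K -> 'I_d.+1}) :
  (forall i : 'I_K, (i < s)%N -> x i = ord_max) ->
  (forall i : 'I_K, (s + t <= i)%N -> x i = ord0) ->
  pad K s (unpad s t x) = x.
Proof.
move=> xmax x0; apply/ffunP => i; rewrite ffunE.
have [lt_i|le_i] := ltnP i s; first by rewrite padn_lt // xmax.
have [lt_i|le_st] := ltnP i (s + t); last by rewrite padn_ge // x0.
have lt_j : (i - s < t)%N by rewrite ltn_subLR.
rewrite -{1}(subnKC le_i) (padn_mid _ _ (Ordinal lt_j)) ffunE /= subnKC //.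
by rewrite valK.
Qed.

Lemma pad_rect K d s t k : (k <= t)%N -> pad K s (rect t d k) = rect K d (s + k).
Proof.
move=> le_kt; apply/ffunP => i; rewrite !ffunE.
have [lt_i|le_i] := ltnP i s; first by rewrite padn_lt // ltn_addr.
have [lt_i|le_st] := ltnP i (s + t); last first.
  by rewrite padn_ge // ltnNge (leq_trans _ le_st) // leq_add2l.
have lt_j : (i - s < t)%N by rewrite ltn_subLR.
by rewrite -{1}(subnKC le_i) (padn_mid _ _ (Ordinal lt_j)) ffunE /= ltn_subLR.
Qed.

(** The forced entries satisfy their interlacing conditions automatically, and
    they put no constraint on the free ones. *)
Lemma interlaces_pad K d s t (z : {ffun 'I_t.+1 -> 'I_d.+1}) (w : {ffun 'I_t -> 'I_d.+1}) :
  (s + t.+1 <= K)%N ->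
  interlaces (pad K s z) (pad K s w) = (w \in family (between z)).
Proof.
move=> leK.
have lt_K (j : 'I_t) : (s + j < K)%N.
  by rewrite (leq_trans _ leK) // ltn_add2l ltnS ltnW.
have lt_K' (j : 'I_t) : (s + j.+1 < K)%N.
  by rewrite (leq_trans _ leK) // ltn_add2l ltnS.
apply/interlacesP/familyP => [[h1 h2] j|h].
  have := h1 (Ordinal (lt_K j)).
  have := h2 (Ordinal (lt_K j)) (Ordinal (lt_K' j)) (addnS _ _).
  rewrite !ffunE /= !padn_mid (padn_mid s z (widen_ord (leqnSn t) j)).
  by rewrite (padn_mid s z (lift ord0 j)) unfold_in /between => -> ->.
split=> [i|i i' ei].
  rewrite !ffunE; have [lt_i|le_i] := ltnP i s; first by rewrite !padn_lt.
  have [lt_i|le_st] := ltnP i (s + t); last by rewrite (padn_ge _ le_st).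
  have lt_j : (i - s < t)%N by rewrite ltn_subLR.
  have := h (Ordinal lt_j); rewrite unfold_in => /andP[_].
  by rewrite -(padn_mid s w) -(padn_mid s z) /= subnKC.
rewrite !ffunE; have [lt_i|le_i] := ltnP i s; first by rewrite (padn_lt _ lt_i) -ltnS.
have [lt_i|le_st] := ltnP i (s + t); last first.
  by rewrite (padn_ge z) // ei addnS ltnS.
have lt_j : (i - s < t)%N by rewrite ltn_subLR.
have := h (Ordinal lt_j); rewrite unfold_in => /andP[+ _].
by rewrite -(padn_mid s w) -(padn_mid s z) /= /bump /= add1n addnS subnKC // ei.
Qed.

Lemma between_nonincr t m (z : {ffun 'I_t.+1 -> 'I_m}) (w : {ffun 'I_t -> 'I_m}) :
  nonincr z -> w \in family (between z) -> nonincr w.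
Proof.
move=> zP /familyP wP i j; rewrite leq_eqVlt => /orP[/eqP/val_inj -> //|lt_ij].
have := wP i; have := wP j; rewrite !unfold_in => /andP[_ hj] /andP[hi _].
apply: leq_trans hj (leq_trans _ hi); apply: zP.
by rewrite /= /bump add1n.
Qed.

(** Going down one row, an entry is at least the one below it and at most the
    one below it and one step to the left; iterating both bounds lets the last
    row control the first. *)
Lemma path_interlaces_bounds K m (x : {ffun 'I_K -> 'I_m}) rows :
  path (@interlaces K m) x rows ->
  (forall i, last x rows i <= x i)%N /\
  (forall i j : 'I_K, i = (j + size rows)%N :> nat -> x i <= last x rows j)%N.
Proof.
elim: rows x => /= [x _|y rows IH x /andP[/interlacesP[h1 h2] /IH[IH1 IH2]]].
  by split=> // i j; rewrite addn0 => /val_inj ->.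
split=> [i|i j eij]; first exact: leq_trans (IH1 i) (h1 i).
have lt_i : (j + size rows < K)%N by rewrite (leq_ltn_trans _ (ltn_ord i)) // eij addnS.
have := IH2 (Ordinal lt_i) j erefl; apply: leq_trans.
by apply: h2; rewrite eij addnS.
Qed.

(** In t steps the bounds transport the s entries d and the zeros of the bottom
    row to the entries that padding prescribes; hence only padded rows
    contribute. *)
Lemma genfun_pattern_support (R : nzRingType) K d s t (x : {ffun 'I_K -> 'I_d.+1}) :
  genfun R (@pattern t K d.+1 x (rect K d s)) != 0 -> pad K s (unpad s t x) = x.
Proof.
move=> nz.
have [p /andP[/path_interlaces_bounds[lo hi] /eqP lastp]] :
    exists p, @pattern t K d.+1 x (rect K d s) p.
  apply/existsP; apply: contraNT nz => /existsPn no; apply/eqP.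
  by rewrite /genfun big1 // => p pP; have := no p; rewrite pP.
rewrite lastp size_map size_enum_ord in lo hi.
apply: pad_unpad => i hi'.
  apply/val_inj/eqP; rewrite eqn_leq -ltnS ltn_ord /=.
  by have := lo i; rewrite ffunE hi'.
have lt_j : (i - t < K)%N by rewrite (leq_ltn_trans (leq_subr _ _)).
have le_ti : (t <= i)%N by rewrite (leq_trans _ hi') // leq_addl.
have := hi i (Ordinal lt_j); rewrite /= subnK // => /(_ erefl).
rewrite ffunE /= ltn_subLR // addnC ltnNge hi' /= leqn0 => /eqP h.
exact/val_inj.
Qed.

Definition vdm_const (R : comPzRingType) (q : R) t : R := \prod_(0 <= i < t) vdm_factor q i.

(** Both sides obey the same branching rule; each of the t rows contributes the
    weight s d of its frozen entries to the power of the variable. *)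
Lemma genfun_pattern_vdm (R : comNzRingType) K d s t (z : {ffun 'I_t -> 'I_d.+1}) :
  (s + t <= K)%N -> nonincr z ->
  vdm_const 'X t * genfun R (@pattern t K d.+1 (pad K s z) (rect K d s)) =
  'X^(t * (s * d)) * vdm ('X : {poly R}) z.
Proof.
elim: t z => [|t IHt] z leK zP.
  rewrite genfun_pattern0 /vdm_const big_geq // mul1r /vdm det_mx00 expr0 mul1r.
  suff -> : pad K s z = rect K d s by rewrite eqxx.
  apply/ffunP => i; rewrite !ffunE; case: ltnP => h; first by rewrite padn_lt.
  by rewrite padn_ge ?addn0.
rewrite genfun_patternS (bigID (fun y => pad K s (unpad s t y) == y)) /=.
rewrite [X in _ + X]big1 ?addr0 => [|y /andP[_ ne]]; last first.
  have [->|/genfun_pattern_support eq_y] :=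
    eqVneq (genfun R (@pattern t K d.+1 y (rect K d s))) 0; first by rewrite mulr0.
  by rewrite eq_y eqxx in ne.
have leK' : (s + t <= K)%N by rewrite (leq_trans _ leK) // leq_add2l.
rewrite (reindex_onto (@pad K d s t) (@unpad K d s t)) => [|y /andP[_ /eqP] //].
rewrite (eq_bigl (fun w => w \in family (between z))) => [|w]; last first.
  by rewrite unpadK // !eqxx !andbT interlaces_pad.
rewrite vdm_branching // /vdm_const big_nat_recr //= -/(vdm_const 'X t).
rewrite -mulrA mulrCA [RHS]mulrCA; congr (_ * _).
rewrite !big_distrr /=; apply: eq_bigr => w wP.
rewrite weight_pad // mulrCA IHt //; last exact: between_nonincr wP.
by rewrite mulSn !exprD; ring.
Qed.

(** Only the zero row interlaces the zero row, so that branching is a recursion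
    with a single term. *)
Lemma vdm0 (R : comPzRingType) (q : R) t d : vdm q (rect t d 0) = vdm_const q t.
Proof.
elim: t => [|t IHt]; first by rewrite /vdm det_mx00 /vdm_const big_geq.
have rP : nonincr (rect t.+1 d 0) by move=> i j _; rewrite !ffunE.
rewrite vdm_branching // /vdm_const big_nat_recr //= -/(vdm_const q t) -IHt mulrC.
congr (_ * _); rewrite (big_pred1 (rect t d 0)) => [|w].
  by rewrite /weight big1 ?expr0 ?mul1r // => i _; rewrite ffunE.
apply/familyP/eqP => [h|-> i]; last by rewrite unfold_in /between !ffunE.
apply/ffunP => i; have := h i; rewrite unfold_in /between !ffunE /= leqn0.
by move/eqP => h'; apply/val_inj.
Qed.

(** * The Vandermonde determinant of a rectangle *)

Lemma vdm_map (R S : comPzRingType) (f : {rmorphism R -> S}) (q : R) t m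
    (z : {ffun 'I_t -> 'I_m}) : f (vdm q z) = vdm (f q) z.
Proof.
rewrite /vdm -det_map_mx; congr (\det _).
by apply/matrixP => i j; rewrite !mxE !rmorphXn.
Qed.

Section ClosedForm.
Variables (F : fieldType) (q : F) (n k : nat).
Hypotheses (q_nonroot : forall m, (0 < m)%N -> 1 - q ^+ m != 0) (le_kn : (k <= n)%N).

(** Up to a factor independent of m, the q-binomial coefficient of m over k. *)
Definition falling m : F := \prod_(0 <= i < k) (1 - q ^+ (m - i)).

Lemma falling_neq0 m : (k <= m)%N -> falling m != 0.
Proof.
move=> le_km; rewrite /falling prodf_seq_neq0; apply/allP => i.
rewrite mem_index_iota /= => lt_ik.
by rewrite q_nonroot // subn_gt0 (leq_trans lt_ik).
Qed.

Lemma qint_neq0 m : (0 < m)%N -> qint q m != 0.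
Proof. by move=> m_gt0; rewrite mulf_neq0 ?invr_eq0 ?q_nonroot // (q_nonroot (ltn0Sn 0)). Qed.

Lemma qfact_neq0 m : qfact q m != 0.
Proof.
rewrite /qfact prodf_seq_neq0; apply/allP => i.
rewrite mem_index_iota => /andP[i_gt0 _]; exact: qint_neq0.
Qed.

Lemma qfact_falling m : (k <= m)%N -> qfact q m = falling m / (1 - q) ^+ k * qfact q (m - k).
Proof.
rewrite /falling; elim: k => [|k' IHk] lt_k.
  by rewrite big_geq // expr0 invr1 mulr1 mul1r subn0.
rewrite IHk ?(ltnW lt_k) // big_nat_recr //= exprS invfM.
have -> : qfact q (m - k') = qfact q (m - k'.+1) * qint q (m - k').
  by rewrite -(subnSK lt_k) /qfact big_nat_recr.
by rewrite /qint; ring.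
Qed.

Lemma qbinom_ratio m m' : (k <= m)%N -> (k <= m')%N ->
  qbinom q m k / qbinom q m' k = falling m / falling m'.
Proof.
move=> le_km le_km'; rewrite /qbinom (qfact_falling le_km) (qfact_falling le_km').
have := falling_neq0 le_km; have := falling_neq0 le_km'.
have := qfact_neq0 (m - k); have := qfact_neq0 (m' - k); have := qfact_neq0 k.
have q1 : 1 - q != 0 by exact: (q_nonroot (ltn0Sn 0)).
have := expf_neq0 k q1.
move: (falling m) (falling m') (qfact _ _) (qfact _ _) (qfact _ _) ((1 - q) ^+ k).
move=> a b c e f g g0 f0 e0 c0 b0 a0; field.
by do ![apply/andP; split].
Qed.

Let entry d (i : 'I_n) := q ^+ (d * (i < k) + rev_ord i).

Lemma vdm_rect d :
  vdm q (rect n d k) = \prod_(i < n) \prod_(j < n | (i < j)%N) (entry d j - entry d i).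
Proof.
rewrite /vdm det_Vandermonde; apply: eq_bigr => i _; apply: eq_bigr => j _.
by rewrite !mxE !ffunE /entry; do 2!case: ltnP => _; rewrite /= ?muln1 ?muln0.
Qed.

(** The factor by which the difference of the nodes i < j changes when the
    rectangle gets one more column; the pairs with i < k <= j are the only ones
    with a contribution other than a power of q. *)
Definition step_ratio d i j : F :=
  if (j < k)%N then q
  else if (i < k)%N then (1 - q ^+ ((j + d).+1 - i)) / (1 - q ^+ (j + d - i)) else 1.

Lemma entry_step d (i j : 'I_n) : (i < j)%N ->
  entry d.+1 j - entry d.+1 i = (entry d j - entry d i) * step_ratio d i j.
Proof.
move=> lt_ij; rewrite /entry /step_ratio.
have [lt_jk|le_kj] := ltnP j k.
  by rewrite (ltn_trans lt_ij lt_jk) !muln1 !addSn !exprS; ring.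
rewrite !muln0 !add0n; have [lt_ik|_] := ltnP i k; last by rewrite !muln0 mulr1.
have nz : 1 - q ^+ (j + d - i) != 0 by rewrite q_nonroot // subn_gt0 ltn_addr.
have e e' : q ^+ rev_ord j - q ^+ (e' + (j - i) + rev_ord j) =
    q ^+ rev_ord j * (1 - q ^+ (j + e' - i)) :> F.
  by rewrite mulrBr mulr1 -exprD; congr (_ - q ^+ _); lia.
have revE : rev_ord i = (j - i + rev_ord j)%N :> nat.
  by have := ltn_ord j; rewrite /=; lia.
rewrite !muln1 revE !addnA !e addnS; field.
exact: nz.
Qed.

(** The pairs i < j < k give the power of q.  For each j >= k the product over
    i < k is a quotient of consecutive values of falling, and the product over
    j telescopes. *)
Lemma prod_step_ratio d :
  \prod_(i < n) \prod_(j < n | (i < j)%N) step_ratio d i j =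
  q ^+ 'C(k, 2) * (falling (n + d) / falling (k + d)).
Proof.
rewrite (exchange_big_dep xpredT) //=.
rewrite (eq_bigr (fun j : 'I_n => \prod_(0 <= i < j) step_ratio d i j)) => [|j _]; last first.
  by rewrite (big_nat_widen _ _ n) ?big_mkord // ltnW.
rewrite -(big_mkord xpredT (fun j => \prod_(0 <= i < j) step_ratio d i j)).
rewrite (@big_cat_nat _ _ _ k) //=; congr (_ * _).
  rewrite -bin2_sum big_nat_cond (eq_bigr (fun j => q ^+ j)) => [|j].
    by rewrite -big_nat_cond expr_sum.
  rewrite andbT /= => lt_jk; rewrite /step_ratio lt_jk.
  by rewrite prodr_const_nat subn0.
have [->|ne_kn] := eqVneq k n.
  by rewrite big_geq // divff // falling_neq0 // (leq_trans le_kn) ?leq_addr.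
have lt_kn : (k < n)%N by rewrite ltn_neqAle ne_kn.
apply: (telescope_prodf_eq (fun j => falling (j + d))) => //
  [j /andP[/ltnW le_kj _]|j /andP[le_kj _]].
  by rewrite falling_neq0 // (leq_trans le_kj) ?leq_addr.
rewrite /step_ratio ltnNge le_kj /= (@big_cat_nat _ _ _ k) //= [X in _ * X]big1_seq ?mulr1.
  rewrite /falling -prodf_div big_nat_cond [RHS]big_nat_cond.
  by apply: eq_bigr => i /andP[/andP[_ lt_ik] _]; rewrite lt_ik addSn.
move=> i; rewrite mem_index_iota => /andP[_ /andP[le_ki _]].
by rewrite ltnNge le_ki.
Qed.

Lemma vdm_rect_qhoggatt d : vdm q (rect n d k) = qhoggatt q d n k * vdm q (rect n d 0).
Proof.
have -> : vdm q (rect n d 0) = \prod_(i < n) \prod_(j < n | (i < j)%N) (entry 0 j - entry 0 i).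
  rewrite /vdm det_Vandermonde; apply: eq_bigr => i _; apply: eq_bigr => j _.
  by rewrite !mxE !ffunE /entry !mul0n.
rewrite vdm_rect; elim: d => [|d IHd].
  by rewrite /qhoggatt mul0n expr0 big_geq // !mul1r.
transitivity ((\prod_(i < n) \prod_(j < n | (i < j)%N) (entry d j - entry d i)) *
    \prod_(i < n) \prod_(j < n | (i < j)%N) step_ratio d i j).
  rewrite -big_split; apply: eq_bigr => i _; rewrite -big_split.
  by apply: eq_bigr => j /entry_step.
rewrite IHd prod_step_ratio /qhoggatt big_nat_recr //= qbinom_ratio ?leq_addr //.
  by rewrite mulSn exprD; ring.
exact: leq_trans (leq_addr _ _).
Qed.

End ClosedForm.

(** * Strong q-log-concavity *)

Lemma genfun_rect_vdm (R : comNzRingType) K d b n k : (b + n <= K)%N -> (k <= n)%N ->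
  vdm_const 'X n * genfun R (@pattern n K d.+1 (rect K d (b + k)) (rect K d b)) =
  'X^(n * (b * d)) * vdm ('X : {poly R}) (rect n d k).
Proof.
move=> leK le_kn; rewrite -(pad_rect _ _ _ le_kn) genfun_pattern_vdm //.
move=> i j le_ij; rewrite !ffunE; case: (ltnP j k) => [lt_jk|_] //.
by rewrite (leq_ltn_trans le_ij lt_jk).
Qed.

Lemma subr1Xn_neq0 (R : nzRingType) m : (0 < m)%N -> 1 - 'X^m != 0 :> {poly R}.
Proof.
move=> m_gt0; apply/eqP => /(congr1 (fun p : {poly R} => p`_0)) /eqP.
by rewrite coefB coef1 coefXn coef0 [(0%N == m)]ltn_eqF // subr0 oner_eq0.
Qed.

Lemma vdm_const_neq0 (R : idomainType) n : vdm_const ('X : {poly R}) n != 0.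
Proof.
rewrite /vdm_const prodf_seq_neq0; apply/allP => t _ /=.
rewrite mulf_neq0 //; apply/prodf_neq0 => i _; first exact: subr1Xn_neq0.
by rewrite expf_neq0 ?polyX_eq0.
Qed.

(** Bottom rect b freezes the first b columns at d.  Removing them would be a
    bijection onto patterns with bottom 0; here it is read off from the
    Vandermonde determinant that evaluates both sides. *)
Lemma genfun_rect_shift (R : idomainType) K d b n k : (b + n <= K)%N -> (k <= n)%N ->
  genfun R (@pattern n K d.+1 (rect K d (b + k)) (rect K d b)) =
  'X^(n * (b * d)) * genfun R (@pattern n K d.+1 (rect K d k) (rect K d 0)).
Proof.
move=> leK le_kn; apply: (mulfI (vdm_const_neq0 R n)).
rewrite genfun_rect_vdm // mulrCA -[k in RHS]add0n genfun_rect_vdm //.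
  by rewrite mul0n muln0 expr0 mul1r.
exact: leq_trans (leq_addl _ _) leK.
Qed.

Lemma tofrac_genfun_rect (R : idomainType) K d n k : (n <= K)%N -> (k <= n)%N ->
  tofrac (genfun R (@pattern n K d.+1 (rect K d k) (rect K d 0))) =
  qhoggatt (fracX R) d n k.
Proof.
move=> leK le_kn; have := @genfun_rect_vdm R K d 0 n k leK le_kn.
rewrite mul0n muln0 expr0 mul1r => /(congr1 (@tofrac _)).
rewrite rmorphM vdm_map vdm_rect_qhoggatt // => [|m m_gt0]; last first.
  by rewrite -rmorphXn -(rmorph1 (@tofrac {poly R})) -rmorphB tofrac_eq0 subr1Xn_neq0.
rewrite -(vdm_map (@tofrac {poly R})) vdm0 mulrC; apply: mulIf.
by rewrite tofrac_eq0 vdm_const_neq0.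
Qed.

Theorem theorem1p3 (R : realType) (d n : nat) (hd : (1 <= d)%N) :
  exists a : nat -> {poly R},
    (forall k : nat, (k <= n)%N -> tofrac (a k) = qhoggatt (fracX R) d n k) /\
    strongly_q_log_concave n a.
Proof.
(* Patterns with bottom row rect 1 have one frozen column besides the n others. *)
pose K := n.+1.
pose gf e b : {poly R} := genfun R (@pattern n K d.+1 (rect K d e) (rect K d b)).
exists (fun k => gf k 0%N).
split=> [k|i j le_ji]; first exact: tofrac_genfun_rect.
rewrite addn1 subn1 => lt_in j_gt0.
have shift k : (k <= n)%N -> gf k.+1 1%N = 'X^(n * (1 * d)) * gf k 0%N.
  by rewrite -add1n; apply: genfun_rect_shift; rewrite add1n.
have le_jn : (j.-1 <= n)%N.
  exact: leq_trans (leq_pred _) (leq_trans le_ji (ltnW lt_in)).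
have : gf i.+1 1%N * gf j 0%N - gf i.+1 0%N * gf j 1%N \is a polyOver Num.nneg.
  by apply: genfun_rect_exchange => //; apply: leqW.
rewrite (shift i (ltnW lt_in)) -{2}(prednK j_gt0) (shift _ le_jn).
rewrite -mulrA [gf i.+1 0%N * _]mulrCA -mulrBr => shifted.
(* The common power of the variable only shifts coefficients. *)
apply/polyOverP => m; move/polyOverP: shifted => /(_ (n * (1 * d) + m)%N).
by rewrite coefXnM ltnNge leq_addr /= addKn.
Qed.
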